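(* For any $n\ge2$ and any $1\le k\le n-1$, there exist $m$, $C\in\mathbb S^n$, a linear map $\mathcal A:\mathbb S^n\to\mathbb R^m$ and $b\in\mathbb R^m$ such that (P) is primal simple with a rank one solution $X_\star$, and for any $\rho>0$ there is an optimal solution $y_\star$ of (D) satisfying strict complementarity such that (AL-BM) with $y=y_\star$ and factor size $n\times k$ admits a spurious local minimizer of rank $k$. In this case, (AL-P) with $y=y_\star$ admits $X_\star$ as its unique optimal solution as well.
   Context: $\mathbb S^n$: real symmetric $n\times n$ matrices with the trace inner product. $\mathcal A^*$ is the adjoint of $\mathcal A$; $Z(y)=C-\mathcal A^*y$. (P): minimize $\langle C,X\rangle$ subject to $\mathcal AX=b$, $X\succeq0$. (D): maximize $\langle b,y\rangle$ subject to $Z(y)\succeq0$. $\mathcal L_\rho(X,y)=\langle C,X\rangle+\langle y,b-\mathcal AX\rangle+\frac\rho2\|\mathcal AX-b\|_2^2$. (AL-P): minimize $\mathcal L_\rho(X,y)$ over $X\succeq0$. (AL-BM): minimize $\mathcal L_\rho(FF^\top,y)$ over $F\in\mathbb R^{n\times k}$. (P) is primal simple if: strong duality holds (an optimal primal-dual pair exists and $\langle C,X\rangle=\langle b,y\rangle$ for any optimal pair $(X,y)$); some optimal pair $(X_\star,y_\star)$ satisfies strict complementarity $\operatorname{rank}(X_\star)+\operatorname{rank}(Z(y_\star))=n$; and the primal solution is unique. A dual optimal $y_\star$ satisfies strict complementarity if the rank equality holds with an optimal $X_\star$. A spurious local minimizer is a local minimizer that is not a global minimizer. *)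

(* Defs.v *)
From HB Require Import structures.
From mathcomp Require Import all_boot all_order all_algebra.
From mathcomp Require Import all_classical all_reals all_analysis.

Set Implicit Arguments.
Unset Strict Implicit.
Unset Printing Implicit Defensive.

Import Order.TTheory GRing.Theory Num.Theory.
Import numFieldNormedType.Exports.

Local Open Scope classical_set_scope.
Local Open Scope ring_scope.

Section SymmetricMatrices.
Variables (R : realType) (n : nat).

Definition sym_pred : pred 'M[R]_n := fun X => X \is symmetricmx.

Lemma sym_predE (X : 'M[R]_n) : (X \in sym_pred) = (X^T == X).
Proof.
by rewrite unfold_in /sym_pred qualifE /= expr0 scale1r map_mx_id // eq_sym.
Qed.

Fact sym_pred_submod_closed : submod_closed sym_pred.
Proof.
split=> [|a X Y]; rewrite !sym_predE ?trmx0 // => /eqP sX /eqP sY.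
by rewrite linearD linearZ /= sX sY.
Qed.

HB.instance Definition _ :=
  GRing.isSubmodClosed.Build R 'M[R]_n sym_pred sym_pred_submod_closed.

Record symmx := SymMx { mx_of_sym :> 'M[R]_n; _ : mx_of_sym \in sym_pred }.

HB.instance Definition _ := [isSub for mx_of_sym].
HB.instance Definition _ := [Choice of symmx by <:].
HB.instance Definition _ := [SubChoice_isSubLmodule of symmx by <:].

Lemma symmx_tr (X : symmx) : (X : 'M[R]_n)^T = X.
Proof. by apply/eqP; rewrite -sym_predE; case: X. Qed.

Fact sym_part_subproof (M : 'M[R]_n) : 2^-1 *: (M + M^T) \in sym_pred.
Proof. by rewrite sym_predE linearZ linearD /= trmxK addrC. Qed.

Definition sym_part (M : 'M[R]_n) : symmx := SymMx (sym_part_subproof M).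

Fact sym_part_is_linear : linear sym_part.
Proof.
move=> a M N; apply: val_inj => /=.
by rewrite linearP /= addrACA -(scalerDr a) [LHS]scalerDr !scalerA mulrC.
Qed.

HB.instance Definition _ :=
  GRing.isLinear.Build R 'M[R]_n symmx *:%R sym_part sym_part_is_linear.

Lemma sym_partK (X : symmx) : sym_part X = X.
Proof.
apply: val_inj; rewrite /= symmx_tr -[X in X + X]scale1r -scalerDl scalerA.
by rewrite mulVf ?scale1r ?pnatr_eq0.
Qed.

Fact gram_subproof k (F : 'M[R]_(n, k)) : F *m F^T \in sym_pred.
Proof. by rewrite sym_predE trmx_mul trmxK. Qed.

Definition gram k (F : 'M[R]_(n, k)) : symmx := SymMx (gram_subproof F).

End SymmetricMatrices.

(* Trace inner product; on column vectors this is the dot product. *)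
Definition inner (R : realType) (p q : nat) (U V : 'M[R]_(p, q)) : R :=
  \tr (U^T *m V).

Fact inner_is_linear (R : realType) (p q : nat) (U : 'M[R]_(p, q)) :
  scalar (inner U).
Proof. by move=> a V W; rewrite /inner mulmxDr -scalemxAr linearP. Qed.

HB.instance Definition _ (R : realType) (p q : nat) (U : 'M[R]_(p, q)) :=
  GRing.isLinear.Build R 'M[R]_(p, q) R *%R (inner U) (inner_is_linear U).

Lemma innerE (R : realType) (p q : nat) (U V : 'M[R]_(p, q)) :
  inner U V = \sum_i \sum_j U i j * V i j.
Proof.
rewrite /inner /mxtrace exchange_big /=; apply: eq_bigr => j _.
by rewrite !mxE; apply: eq_bigr => i _; rewrite !mxE.
Qed.

Definition psd (R : realType) (n : nat) (X : symmx R n) : Prop :=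
  forall v : 'cV[R]_n, 0 <= inner v (X *m v).

Section Adjoint.
Variables (R : realType) (n m : nat).
Variable A : {linear symmx R n -> 'cV[R]_m}.

Fact adjoint_subproof (y : 'cV[R]_m) :
  \matrix_(i, j) inner y (A (sym_part (delta_mx i j))) \in @sym_pred R n.
Proof.
rewrite sym_predE; apply/eqP/matrixP => i j; rewrite !mxE.
congr (inner y (A _)); apply: val_inj => /=.
by rewrite !trmx_delta addrC.
Qed.

(* The (i, j) entry of A^* y is its inner product with the orthogonal
   projection of the matrix unit E_ij onto the symmetric matrices;
   adjointP below is the defining property. *)
Definition adjoint (y : 'cV[R]_m) : symmx R n := SymMx (adjoint_subproof y).

Lemma adjointP (y : 'cV[R]_m) (X : symmx R n) :
  inner (adjoint y) X = inner y (A X).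
Proof.
rewrite innerE -[X in RHS]sym_partK [in RHS](matrix_sum_delta X) !linear_sum /=.
apply: eq_bigr => i _; rewrite !linear_sum; apply: eq_bigr => j _ /=.
by rewrite !linearZ /= mxE mulrC.
Qed.

End Adjoint.

Section SDP.
Variables (R : realType) (n m : nat).
Variables (C : symmx R n) (A : {linear symmx R n -> 'cV[R]_m}) (b : 'cV[R]_m).

Definition primal_feasible (X : symmx R n) : Prop := A X = b /\ psd X.

Definition primal_optimal (X : symmx R n) : Prop :=
  primal_feasible X /\
  forall X', primal_feasible X' -> inner C X <= inner C X'.

Definition slack (y : 'cV[R]_m) : symmx R n := C - adjoint A y.

Definition dual_feasible (y : 'cV[R]_m) : Prop := psd (slack y).

Definition dual_optimal (y : 'cV[R]_m) : Prop :=
  dual_feasible y /\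
  forall y', dual_feasible y' -> inner b y' <= inner b y.

Definition strong_duality : Prop :=
  (exists X y, primal_optimal X /\ dual_optimal y) /\
  forall X y, primal_optimal X -> dual_optimal y -> inner C X = inner b y.

Definition strictly_complementary (y : 'cV[R]_m) : Prop :=
  exists X, primal_optimal X /\ (\rank X + \rank (slack y))%N = n.

Definition primal_simple : Prop :=
  [/\ strong_duality,
      exists y, dual_optimal y /\ strictly_complementary y
    & exists! X, primal_optimal X].

Definition auglag (rho : R) (y : 'cV[R]_m) (X : symmx R n) : R :=
  inner C X + inner y (b - A X) + rho / 2 * inner (A X - b) (A X - b).

Definition ALP_optimal (rho : R) (y : 'cV[R]_m) (X : symmx R n) : Prop :=
  psd X /\ forall X', psd X' -> auglag rho y X <= auglag rho y X'.

Definition ALBM_objective (rho : R) (y : 'cV[R]_m) (k : nat)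
    (F : 'M[R]_(n, k)) : R :=
  auglag rho y (gram F).

End SDP.

Definition global_minimizer (R : realType) (T : Type) (f : T -> R) (x : T) :
  Prop := forall x', f x <= f x'.

Definition local_minimizer (R : realType) (T : topologicalType) (f : T -> R)
  (x : T) : Prop := \forall x' \near x, f x <= f x'.

Definition spurious_local_minimizer (R : realType) (T : topologicalType)
  (f : T -> R) (x : T) : Prop := local_minimizer f x /\ ~ global_minimizer f x.

(* Main.v *)
(** If A is injective and b = A X0, then X0 is the only feasible point, and every
    y with Z(y) positive semidefinite and orthogonal to X0 is dual optimal; the
    augmented Lagrangian at such a y is <b,y> + <Z(y),X> + rho/2 |A(X - X0)|^2,
    so only the quadratic form |A X|^2 and Z(y) remain to be chosen. With indices
    starting at 0, X0 = (k+2) E_00, C = 0 and Z(y) = rho diag(0,1,...,1), take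
      |A X|^2 = (X_00 + t)^2 + sum_(i > 0) X_ii^2 + (k+2)^2 sum_(i <> j) X_ij^2,
    where t = X_11 + ... + X_kk. The coupling of X_00 with t makes F = [0; I_k; 0]
    a stationary point of value rho (2 + 3k/2), while the minimum is 0. To
    descend, X_00 has to increase, but X = F F^T with F near [0; I_k; 0] satisfies
    X_01^2 + ... + X_0k^2 >= X_00 / 2, and the off-diagonal penalty dominates. *)
From HB Require Import structures.
Require Import Defs.
From mathcomp Require Import all_boot all_order all_algebra.
From mathcomp Require Import all_classical all_reals all_analysis.
From mathcomp Require Import ring lra zify.

Set Implicit Arguments.
Unset Strict Implicit.
Unset Printing Implicit Defensive.

Import Order.TTheory GRing.Theory Num.Theory.
Import numFieldNormedType.Exports.

Local Open Scope ring_scope.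

(** * Trace inner product and positive semidefinite Gram matrices *)

Lemma innerC (R : realType) (p q : nat) (U V : 'M[R]_(p, q)) :
  inner U V = inner V U.
Proof.
by rewrite !innerE; do 2!(apply: eq_bigr => ? _); rewrite mulrC.
Qed.

Lemma innerBl (R : realType) (p q : nat) (U V W : 'M[R]_(p, q)) :
  inner (U - V) W = inner U W - inner V W.
Proof. by rewrite innerC linearB /= !(innerC W). Qed.

Lemma inner_ge0 (R : realType) (p q : nat) (U : 'M[R]_(p, q)) :
  0 <= inner U U.
Proof. by rewrite innerE; do 2!(apply: sumr_ge0 => ? _); exact: sqr_ge0. Qed.

Lemma inner_eq0 (R : realType) (p q : nat) (U : 'M[R]_(p, q)) :
  (inner U U == 0) = (U == 0).
Proof.
apply/eqP/eqP => [|->]; last by rewrite linear0.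
rewrite innerE pair_bigA /= => /eqP.
rewrite psumr_eq0 => [/allP U0|i _]; last exact: sqr_ge0.
apply/matrixP => i j; rewrite mxE; apply/eqP; rewrite -[_ == _]orbb -mulf_eq0.
exact: (U0 (i, j) (mem_index_enum _)).
Qed.

Lemma inner_mxvec (R : realType) (p q : nat) (U V : 'M[R]_(p, q)) :
  inner (mxvec U)^T (mxvec V)^T = inner U V.
Proof.
rewrite !innerE [RHS]pair_bigA /= (reindex _ (curry_mxvec_bij p q)) /=.
by apply: eq_bigr => -[i j] _; rewrite big_ord1 !mxE !mxvecE.
Qed.

(** The inner product is tr(G^T Z G), the sum of g^T Z g over the columns g of [G]. In the duality
    arguments one matrix always comes with a Gram factor, so no square root of a semidefinite matrix
    has to be constructed. *)
Lemma inner_psd_gram (R : realType) (n k : nat) (Z : symmx R n)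
    (G : 'M[R]_(n, k)) : psd Z -> 0 <= inner Z (gram G).
Proof.
move=> psdZ; rewrite innerC /inner /= trmx_mul trmxK -mulmxA mxtrace_mulC.
rewrite -mulmxA.
rewrite /mxtrace; apply: sumr_ge0 => j _; have := psdZ (col j G).
rewrite /inner /mxtrace big_ord1 (_ : _ 0 0 = (G^T *m (Z *m G)) j j) //.
rewrite !mxE; apply: eq_bigr => i _; rewrite !mxE; congr (_ * _).
by apply: eq_bigr => l _; rewrite !mxE.
Qed.

Lemma psd_gram (R : realType) (n k : nat) (G : 'M[R]_(n, k)) : psd (gram G).
Proof.
move=> v; rewrite /= -mulmxA (_ : inner _ _ = inner (G^T *m v) (G^T *m v)).
  exact: inner_ge0.
by rewrite /inner trmx_mul trmxK !mulmxA.
Qed.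

(** * Duality and (AL-P) for an injective constraint map *)

Section InjectiveConstraint.
Variables (R : realType) (n m k l : nat) (C : symmx R n).
Variables (A : {linear symmx R n -> 'cV[R]_m}) (Gx : 'M[R]_(n, k)).
Hypothesis injA : injective A.

Local Notation Xstar := (gram Gx).
Local Notation b := (A Xstar).

Lemma primal_optimal_injective (X : symmx R n) :
  primal_optimal C A b X <-> X = Xstar.
Proof.
split=> [[[/injA]]|->] //; split=> [|X' [/injA -> //]].
by split; last exact: psd_gram.
Qed.

Lemma inner_slack (y : 'cV[R]_m) (X : symmx R n) :
  inner (slack C A y) X = inner C X - inner y (A X).
Proof. by rewrite -adjointP innerBl. Qed.

(** As [b] is the image of [Xstar], the residual is A(X - Xstar), and <C,X> - <y,AX> collects into
    the slack term. *)
Lemma auglag_slack (rho : R) (y : 'cV[R]_m) (X : symmx R n) :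
  auglag C A b rho y X = inner b y + inner (slack C A y) X
    + rho / 2 * inner (A (X - Xstar)) (A (X - Xstar)).
Proof.
by rewrite /auglag inner_slack [A (_ - _)]linearB linearB /= (innerC _ y); ring.
Qed.

Lemma weak_duality (y : 'cV[R]_m) :
  dual_feasible C A y -> inner b y <= inner C Xstar.
Proof.
by move=> /(inner_psd_gram Gx); rewrite inner_slack (innerC y) subr_ge0.
Qed.

Variables (y : 'cV[R]_m) (Gz : 'M[R]_(n, l)).
Hypotheses (slackE : slack C A y = gram Gz) (compl : inner (gram Gz) Xstar = 0).

Lemma inner_dual_complementary : inner b y = inner C Xstar.
Proof. by move: compl; rewrite -slackE inner_slack (innerC y); lra. Qed.

Lemma dual_optimal_complementary : dual_optimal C A b y.
Proof.
split=> [|y' /weak_duality]; last by rewrite inner_dual_complementary.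
by rewrite /dual_feasible slackE; exact: psd_gram.
Qed.

Lemma strong_duality_complementary : strong_duality C A b.
Proof.
split=> [|X y' /primal_optimal_injective -> [fy' oy']].
  exists Xstar, y; split; last exact: dual_optimal_complementary.
  exact/primal_optimal_injective.
(* The value of [y'] is at least that of [y], which equals <C,Xstar>, and weak duality bounds it by
   the same number from above. *)
have [fy _] := dual_optimal_complementary.
have := oy' _ fy; have := weak_duality fy'; rewrite inner_dual_complementary.
lra.
Qed.

Lemma strictly_complementary_rank :
  (\rank Xstar + \rank (gram Gz))%N = n -> strictly_complementary C A b y.
Proof.
by exists Xstar; rewrite slackE; split=> //; exact/primal_optimal_injective.
Qed.

Lemma primal_simple_complementary :
  (\rank Xstar + \rank (gram Gz))%N = n -> primal_simple C A b.
Proof.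
move=> rk; split; first exact: strong_duality_complementary.
  exists y; split; first exact: dual_optimal_complementary.
  exact: strictly_complementary_rank.
exists Xstar; split=> [|X /primal_optimal_injective //].
exact/primal_optimal_injective.
Qed.

Lemma auglag_complementary (rho : R) :
  auglag C A b rho y Xstar = inner b y.
Proof. by rewrite auglag_slack slackE compl subrr !linear0; ring. Qed.

(** On the semidefinite cone the slack term is nonnegative, so the excess over the value <b,y> at
    [Xstar] is at least rho/2 |A(X - Xstar)|^2, which by injectivity vanishes only at [Xstar]. *)
Lemma ALP_optimal_complementary (rho : R) (X : symmx R n) : 0 < rho ->
  ALP_optimal C A b rho y X <-> X = Xstar.
Proof.
move=> rho_gt0; have lower (X' : symmx R n) : psd X' ->
    inner b y + rho / 2 * inner (A (X' - Xstar)) (A (X' - Xstar))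
      <= auglag C A b rho y X'.
  move=> /(inner_psd_gram Gz); rewrite auglag_slack slackE innerC; lra.
split=> [[psdX oX]|->]; last first.
  split=> [|X' /lower]; first exact: psd_gram.
  rewrite auglag_complementary; apply: le_trans; rewrite lerDl.
  by rewrite mulr_ge0 ?inner_ge0 // divr_ge0 // ltW.
have := lower _ psdX; have := oX _ (psd_gram Gx).
rewrite auglag_complementary => ub /le_trans/(_ ub); rewrite gerDl.
rewrite pmulr_rle0 ?divr_gt0 // => le0.
have : inner (A (X - Xstar)) (A (X - Xstar)) == 0.
  by rewrite eq_le le0 inner_ge0.
by rewrite inner_eq0 linearB subr_eq0 => /eqP/injA.
Qed.

End InjectiveConstraint.

(** A symmetric matrix is determined by its inner products with symmetric matrices: the difference
    [D] is tested against itself. This identifies the slack without computing the adjoint. *)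
Lemma slack_eq (R : realType) (n m : nat) (C Z : symmx R n)
    (A : {linear symmx R n -> 'cV[R]_m}) (y : 'cV[R]_m) :
  (forall X : symmx R n, inner Z X = inner C X - inner y (A X)) ->
  slack C A y = Z.
Proof.
move=> ZE; apply/eqP; rewrite -subr_eq0; set D := slack C A y - Z.
have /eqP : inner D D = 0.
  rewrite {1}(_ : mx_of_sym D = mx_of_sym (slack C A y) - mx_of_sym Z) //.
  by rewrite innerBl inner_slack ZE subrr.
by rewrite inner_eq0 => /eqP D0; apply/eqP/val_inj.
Qed.

(** * Gram factors of scaled matrix units and of scaled diag(0,1,...,1) *)

Lemma gram_scale_delta (R : realType) (n k : nat) (c : R) (i : 'I_n)
    (j : 'I_k) :
  0 <= c -> gram (Num.sqrt c *: delta_mx i j) = c *: delta_mx i i :> 'M[R]_n.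
Proof.
move=> c0; rewrite /= [(_ *: _)^T]linearZ /= -scalemxAl -scalemxAr scalerA.
by rewrite -expr2 sqr_sqrtr // trmx_delta mul_delta_mx.
Qed.

Lemma copid_mx1E (R : realType) (n : nat) (i j : 'I_n.+1) :
  (copid_mx 1 : 'M[R]_n.+1) i j = ((i == j) && (i != ord0))%:R.
Proof.
rewrite !mxE (_ : (i < 1)%N = (i == ord0)); last by rewrite ltnS leqn0.
rewrite (_ : (i == j :> nat) = (i == j)) //.
by case: (i == j); case: (i == ord0); rewrite ?subrr ?subr0.
Qed.

Lemma inner_copid_mx1 (R : realType) (n : nat) (M : 'M[R]_n.+1) :
  inner (copid_mx 1) M = \sum_(i < n) M (lift ord0 i) (lift ord0 i).
Proof.
rewrite innerE big_ord_recl big1 ?add0r => [|j _]; last first.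
  by rewrite copid_mx1E andbF mul0r.
apply: eq_bigr => i _; rewrite (bigD1 (lift ord0 i)) //= big1 => [|j ji].
  by rewrite copid_mx1E eqxx mul1r addr0.
by rewrite copid_mx1E eq_sym (negbTE ji) mul0r.
Qed.

Lemma gram_scale_copid (R : realType) (n r : nat) (c : R) :
  (r <= n)%N -> 0 <= c ->
  gram (Num.sqrt c *: copid_mx r) = c *: copid_mx r :> 'M[R]_n.
Proof.
move=> rn c0; rewrite /= [(_ *: _)^T]linearZ /= -scalemxAl -scalemxAr scalerA.
rewrite -expr2 sqr_sqrtr // /copid_mx linearB /= trmx1 tr_pid_mx.
by rewrite -/(copid_mx r) mulmxBr mulmx1 mul_copid_mx_pid // subr0.
Qed.

(** * The instance: constraint map, primal solution and dual solution *)

Section Construction.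
Variables (R : realType) (k m : nat).
Local Notation N := (k + m).+1.

Definition block (l : 'I_k) : 'I_N := lift ord0 (lshift m l).

(** The squared Frobenius norm of this matrix is the quadratic form |A X|^2. *)
Definition weighted_entries (X : 'M[R]_N) : 'M[R]_N :=
  \matrix_(i, j) ((if i == j then 1 else k.+2%:R) * X i j
    + (if (i == ord0) && (j == ord0)
       then \sum_(l < k) X (block l) (block l) else 0)).

Lemma weighted_entries_offdiag (X : 'M[R]_N) i j : i != j ->
  weighted_entries X i j = k.+2%:R * X i j.
Proof.
move=> ij; rewrite mxE (negbTE ij); case: ifP => [/andP[/eqP i0 /eqP j0]|_].
  by rewrite i0 j0 eqxx in ij.
by rewrite addr0.
Qed.

Lemma weighted_entries_diag (X : 'M[R]_N) i : i != ord0 ->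
  weighted_entries X i i = X i i.
Proof. by move=> i0; rewrite mxE eqxx (negbTE i0) mul1r addr0. Qed.

Lemma weighted_entries_00 (X : 'M[R]_N) :
  weighted_entries X ord0 ord0
  = X ord0 ord0 + \sum_(l < k) X (block l) (block l).
Proof. by rewrite mxE eqxx mul1r. Qed.

Definition weighted_op (X : symmx R N) : 'cV[R]_(N * N) :=
  (mxvec (weighted_entries X))^T.

Fact weighted_op_is_linear : linear weighted_op.
Proof.
move=> a X Y; rewrite /weighted_op -!linearP; congr (mxvec _)^T.
apply/matrixP => i j; rewrite !mxE /=.
under eq_bigr do rewrite !mxE.
rewrite big_split /= -mulr_sumr; do 2!case: ifP => _; ring.
Qed.

HB.instance Definition _ := GRing.isLinear.Build R (symmx R N) 'cV[R]_(N * N)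
  *:%R weighted_op weighted_op_is_linear.

(** The map is triangular: every entry except (0,0) is only rescaled, and once the diagonal block
    vanishes the coupled entry returns X_00. *)
Lemma weighted_op_inj : injective weighted_op.
Proof.
apply: raddf_inj => X /eqP; rewrite trmx_eq0 mxvec_eq0 => /eqP X0.
have Xd i : i != ord0 -> X i i = 0.
  by move=> i0; rewrite -weighted_entries_diag // X0 mxE.
apply: val_inj; apply/matrixP => i j; rewrite [RHS]mxE.
have [<-|ij] := eqVneq i j.
  have [->|] := eqVneq i ord0; last exact: Xd.
  have := weighted_entries_00 X; rewrite X0 mxE big1 ?addr0 // => l _.
  exact: Xd.
have := weighted_entries_offdiag X ij; rewrite X0 mxE => /esym/eqP.
by rewrite mulf_eq0 pnatr_eq0 /= => /eqP.
Qed.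

(** The factor k+2 makes the (0,0) residual at diag(0, I_k, 0) equal to -2. The derivative of the
    objective over rho in each block diagonal entry is then 1 - 2 + 1 = 0. *)
Definition solF : 'M[R]_(N, 1) := Num.sqrt k.+2%:R *: delta_mx ord0 ord0.

(** This vector pairs only with the diagonal entries i > 0, which the map leaves unchanged, so its
    adjoint image is -rho diag(0,1,...,1). *)
Definition ydual (rho : R) : 'cV[R]_(N * N) :=
  - rho *: (mxvec (copid_mx 1))^T.

Definition slackF (rho : R) : 'M[R]_N := Num.sqrt rho *: copid_mx 1.

Lemma gram_solF : gram solF = k.+2%:R *: delta_mx ord0 ord0 :> 'M[R]_N.
Proof. exact: gram_scale_delta. Qed.

Lemma inner_gram_slackF (rho : R) (X : 'M[R]_N) : 0 <= rho ->
  inner (gram (slackF rho)) X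
  = rho * \sum_(i < k + m) X (lift ord0 i) (lift ord0 i).
Proof.
move=> rho0.
by rewrite gram_scale_copid // innerC linearZ /= innerC inner_copid_mx1.
Qed.

Lemma slack_ydual (rho : R) : 0 <= rho ->
  slack 0 weighted_op (ydual rho) = gram (slackF rho).
Proof.
move=> rho0; apply: slack_eq => X; rewrite inner_gram_slackF //.
rewrite [inner 0 _]innerC linear0 sub0r [inner (ydual _) _]innerC linearZ /=.
rewrite mulNr opprK innerC inner_mxvec inner_copid_mx1; congr (_ * _).
by apply: eq_bigr => i _; rewrite weighted_entries_diag.
Qed.

Lemma inner_slackF_solF (rho : R) : 0 <= rho ->
  inner (gram (slackF rho)) (gram solF) = 0.
Proof.
move=> rho0; rewrite inner_gram_slackF // big1 ?mulr0 // => i _.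
by rewrite gram_solF !mxE /= mulr0.
Qed.

Lemma rank_gram_solF : \rank (gram solF) = 1%N.
Proof. by rewrite gram_solF mxrank_scale_nz ?pnatr_eq0 // mxrank_delta. Qed.

Lemma rank_gram_slackF (rho : R) : 0 < rho ->
  \rank (gram (slackF rho)) = (k + m)%N.
Proof.
move=> rho0; rewrite gram_scale_copid ?ltW // mxrank_scale_nz ?gt_eqF //.
by rewrite rank_copid_mx // subn1.
Qed.
End Construction.

(** * The objective near [0; I_k; 0] *)

Lemma sum_block_le (R : realType) (k m : nat)
    (c : 'I_(k + m).+1 -> 'I_(k + m).+1 -> R) : (forall i j, 0 <= c i j) ->
  c ord0 ord0 + \sum_(l < k) (c ord0 (block m l)
    + (c (block m l) ord0 + c (block m l) (block m l)))
  <= \sum_i \sum_j c i j.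
Proof.
move=> c0; rewrite big_ord_recl [X in _ <= X + _]big_ord_recl -addrA lerD2l.
(* Entry (0,i) and row i are summed together over i > 0, so a single split discards the last [m]
   indices from both. *)
rewrite -big_split big_split_ord /=; apply: ler_wpDr.
  by apply: sumr_ge0 => i _; rewrite addr_ge0 // sumr_ge0.
apply: ler_sum => l _; rewrite big_ord_recl /= !lerD2l (bigD1 (lshift m l)) //=.
by rewrite lerDl sumr_ge0.
Qed.

Section LocalMinimizer.
Variables (R : realType) (k m : nat).
Local Notation N := (k + m).+1.
Local Notation solF := (solF R k m).
Local Notation ydual := (@ydual R k m).
Local Notation A := (@weighted_op R k m).
Local Notation obj rho := (auglag 0 A (A (gram solF)) rho (ydual rho)).

(** Here <b,y> = <C,X0> = 0. As the slack is proportional to rho, rho factors out of the whole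
    objective, and one point can serve every rho. *)
Lemma auglag_residual (rho : R) (X : symmx R N) : 0 <= rho ->
  obj rho X = rho * (\sum_(i < k + m) X (lift ord0 i) (lift ord0 i)
    + 2^-1 * \sum_i \sum_j
        (weighted_entries (mx_of_sym X - mx_of_sym (gram solF)) i j) ^+ 2).
Proof.
move=> rho0; rewrite auglag_slack slack_ydual // inner_gram_slackF //.
rewrite (inner_dual_complementary (slack_ydual k m rho0)
  (inner_slackF_solF k m rho0)).
rewrite innerC linear0 add0r mulrDr mulrA; congr (_ + _ * _).
by rewrite inner_mxvec innerE; do 2!(apply: eq_bigr => ? _); rewrite expr2.
Qed.

Lemma residual_00 (X : symmx R N) :
  weighted_entries (mx_of_sym X - mx_of_sym (gram solF)) ord0 ord0
  = X ord0 ord0 + \sum_(l < k) X (block m l) (block m l) - k.+2%:R.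
Proof.
rewrite weighted_entries_00 gram_solF !mxE /= mulr1 addrAC; congr (_ + _ - _).
by apply: eq_bigr => l _; rewrite !mxE /= mulr0 subr0.
Qed.

Lemma residual_diag (X : symmx R N) i : i != ord0 ->
  weighted_entries (mx_of_sym X - mx_of_sym (gram solF)) i i = X i i.
Proof.
move=> i0; rewrite weighted_entries_diag // gram_solF !mxE (negbTE i0).
by rewrite mulr0 subr0.
Qed.

Lemma residual_offdiag (X : symmx R N) i j : i != j ->
  weighted_entries (mx_of_sym X - mx_of_sym (gram solF)) i j
  = k.+2%:R * X i j.
Proof.
move=> ij; rewrite weighted_entries_offdiag // gram_solF !mxE.
case: eqP => [i0|_]; case: eqP => [j0|_]; rewrite ?mulr0 ?subr0 //.
by rewrite i0 j0 eqxx in ij.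
Qed.

(** With p = X_00, the (0,0) square contributes the loss -2(k+2)p, which the off-diagonal penalty
    compensates. What remains is (t-k)^2/2 + 2 + 3k/2 plus nonnegative terms. *)
Lemma auglag_ge (rho : R) (X : symmx R N) : 0 <= rho -> psd X ->
  X ord0 ord0 <= 2 * \sum_(l < k) X ord0 (block m l) ^+ 2 ->
  rho * (2 + 3 / 2 * k%:R) <= obj rho X.
Proof.
move=> rho0 psdX Xcross; rewrite auglag_residual // ler_wpM2l //.
have Xdiag i : 0 <= X i i.
  have := psdX (delta_mx i 0); rewrite innerE.
  rewrite (bigD1 i) //= big_ord1 big1 ?addr0 => [|j ji]; last first.
    by rewrite big_ord1 !mxE (negbTE ji) mul0r.
  rewrite -colE !mxE !eqxx mul1r //.
rewrite big_split_ord /=; set t := \sum_(l < k) X _ _.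
set u := \sum_(l < m) _; have u0 : 0 <= u by apply: sumr_ge0.
set s := \sum_i _; set p := X ord0 ord0 in Xcross *.
have p0 : 0 <= p by exact: Xdiag.
have t0 : 0 <= t by apply: sumr_ge0.
have sge : (p + t - k.+2%:R) ^+ 2
    + (k.+2%:R ^+ 2 * (2 * \sum_(l < k) X ord0 (block m l) ^+ 2)
    + (2 * t - k%:R)) <= s.
  have := sum_block_le (fun i j => sqr_ge0
    (weighted_entries (mx_of_sym X - mx_of_sym (gram solF)) i j)).
  apply: le_trans; rewrite residual_00 lerD2l.
  have -> : k%:R = \sum_(l < k) 1 :> R by rewrite sumr_const card_ord.
  rewrite !mulr_sumr -sumrB -big_split /=.
  apply: ler_sum => l _; rewrite residual_diag // !residual_offdiag //.
  rewrite (_ : X (block m l) ord0 = X ord0 (block m l)) ?exprMn; last first.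
    by rewrite -[in LHS](symmx_tr X) mxE.
  (* The tangent bound x^2 >= 2x - 1 at x = 1 sums to 2t - k. *)
  have := sqr_ge0 (X (block m l) (block m l) - 1).
  nra.
have k0 : 0 <= k%:R :> R by exact: ler0n.
have kE : k.+2%:R = k%:R + 2 :> R by rewrite -addn2 natrD.
rewrite kE in sge.
(* The assumed bound on p turns the penalty into (k+2)^2 p, and k+2 >= 2. *)
have cross : (k%:R + 2) * 2 * p <=
    (k%:R + 2) ^+ 2 * (2 * \sum_(l < k) X ord0 (block m l) ^+ 2).
  apply: (@le_trans _ _ ((k%:R + 2) ^+ 2 * p)); first nra.
  by rewrite ler_wpM2l ?sqr_ge0.
have := sqr_ge0 (t - k%:R); nra.
Qed.

Definition blockF : 'M[R]_(N, k) := \matrix_(i, l) (i == block m l)%:R.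

Lemma block_inj : injective (@block k m).
Proof. by move=> i j /lift_inj/lshift_inj. Qed.

Lemma rank_blockF : \rank blockF = k.
Proof.
apply/eqP; rewrite eqn_leq rank_leq_col /=.
have : blockF^T *m blockF = 1%:M.
  apply/matrixP => i j; rewrite !mxE (bigD1 (block m i)) //= !mxE eqxx mul1r.
  rewrite big1 => [|l li]; last by rewrite !mxE (negbTE li) mul0r.
  by rewrite addr0 (inj_eq block_inj).
by move=> /(congr1 mxrank); rewrite mxrank1 => rk;
  rewrite -[X in (X <= _)%N]rk; exact: mxrankM_maxr.
Qed.

Lemma gram_entry (F : 'M[R]_(N, k)) i j :
  gram F i j = \sum_(l < k) F i l * F j l.
Proof. by rewrite /= mxE; apply: eq_bigr => l _; rewrite !mxE. Qed.

(** The Gram matrix is diag(0, I_k, 0): the linear term gives k and the squared residuals give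
    ((-2)^2 + k)/2. *)
Lemma auglag_blockF (rho : R) : 0 <= rho ->
  obj rho (gram blockF) = rho * (2 + 3 / 2 * k%:R).
Proof.
move=> rho0; rewrite auglag_residual //; congr (_ * _).
have G0 j : gram blockF ord0 j = 0.
  by rewrite gram_entry big1 // => l _; rewrite mxE /= mul0r.
have Gb l i : gram blockF (block m l) i = (i == block m l)%:R.
  rewrite gram_entry (bigD1 l) //= big1 ?addr0 => [|r rl].
    by rewrite !mxE eqxx mul1r.
  by rewrite !mxE (inj_eq block_inj) eq_sym (negbTE rl) mul0r.
have Gr (r : 'I_m) i : gram blockF (lift ord0 (rshift k r)) i = 0.
  rewrite gram_entry big1 // => l _; rewrite mxE (inj_eq lift_inj).
  by rewrite eq_rlshift mul0r.
move: (gram blockF) G0 Gb Gr => X G0 Gb Gr.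
have tE : \sum_(l < k) X (block m l) (block m l) = k%:R.
  by under eq_bigr do rewrite Gb eqxx; rewrite sumr_const card_ord.
rewrite big_split_ord /= tE [X in _ + X + _]big1 => [|r _]; last exact: Gr.
rewrite [X in _ * X]big_ord_recl [X in _ * (X + _)]big_ord_recl residual_00.
rewrite G0 tE /=.
rewrite [X in _ ^+ 2 + X]big1 => [|i _]; last first.
  by rewrite residual_offdiag // G0 mulr0 expr0n.
rewrite big_split_ord /= [X in _ * (_ + (_ + X))]big1 => [|r _]; last first.
  rewrite big1 // => j _; have [<-|rj] := eqVneq (lift ord0 (rshift k r)) j.
    by rewrite residual_diag // Gr expr0n.
  by rewrite residual_offdiag // Gr mulr0 expr0n.
rewrite (eq_bigr (fun=> 1)) => [|l _]; last first.
  rewrite (bigD1 (block m l)) //= residual_diag // Gb eqxx expr1n.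
  rewrite big1 ?addr0 //.
  move=> j jl; rewrite residual_offdiag ?(eq_sym _ j) // Gb (negbTE jl).
  by rewrite mulr0 expr0n.
have kE : k.+2%:R = k%:R + 2 :> R by rewrite -addn2 natrD.
by rewrite sumr_const card_ord kE; field.
Qed.

(** The block rows of [F] are close to the identity, so the entries X_0l are close to the first row
    f of [F], while X_00 = |f|^2. *)
Lemma near_blockF_first_row (F : 'M[R]_(N, k)) (e : R) : k%:R * e <= 4^-1 ->
  (forall i j, `|blockF i j - F i j| < e) ->
  gram F ord0 ord0 <= 2 * \sum_(l < k) gram F ord0 (block m l) ^+ 2.
Proof.
move=> ke Fe; set f := F ord0.
set p := gram F ord0 ord0.
have pE : p = \sum_(l < k) f l ^+ 2 by exact: gram_entry.
have p0 : 0 <= p by rewrite pE; apply: sumr_ge0 => l _; exact: sqr_ge0.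
(* Each F_lr differs from the identity entry by less than [e], and |f_l f_r| <= (f_l^2 +
   f_r^2)/2. *)
have bnd l : f l ^+ 2 - e / 2 * (k%:R * f l ^+ 2 + p)
    <= f l * gram F ord0 (block m l).
  have flE : f l ^+ 2 = \sum_(r < k) (r == l)%:R * f r ^+ 2.
    rewrite (bigD1 l) //= eqxx mul1r big1 ?addr0 // => r rl.
    by rewrite (negbTE rl) mul0r.
  have -> : k%:R * f l ^+ 2 + p = \sum_(r < k) (f l ^+ 2 + f r ^+ 2).
    by rewrite big_split /= sumr_const card_ord mulr_natl -pE.
  rewrite {1}flE gram_entry !mulr_sumr -sumrB; apply: ler_sum => r _.
  have := Fe (block m l) r; rewrite mxE (inj_eq block_inj) eq_sym -/f.
  rewrite ltr_norml => /andP[lo hi].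
  have := sqr_ge0 (f l - f r); have := sqr_ge0 (f l + f r).
  by case: eqP lo hi => [->|_] /=; nra.
have sumb : p - k%:R * e * p <= \sum_(l < k) f l * gram F ord0 (block m l).
  apply: le_trans (ler_sum _ (fun l _ => bnd l)).
  rewrite sumrB -mulr_sumr big_split /= -mulr_sumr -pE sumr_const card_ord.
  rewrite -[p *+ k]mulr_natl; lra.
(* From x^2 >= 2fx - f^2 and k e <= 1/4, the sum of squares is at least 2(3/4)p - p = p/2. *)
have sq : \sum_(l < k) (2 * (f l * gram F ord0 (block m l)) - f l ^+ 2)
    <= \sum_(l < k) gram F ord0 (block m l) ^+ 2.
  apply: ler_sum => l _; have := sqr_ge0 (gram F ord0 (block m l) - f l).
  rewrite sqrrB; lra.
move: sq; rewrite sumrB -mulr_sumr -pE => sq.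
have := ler_wpM2r p0 ke; lra.
Qed.

End LocalMinimizer.

(** * Spuriousness and assembly of the theorem *)

Lemma auglag_solF (R : realType) (k m : nat) (rho : R) : 0 <= rho ->
  auglag 0 (@weighted_op R k m) (weighted_op (gram (solF R k m))) rho
    (@ydual R k m rho) (gram (solF R k m)) = 0.
Proof.
move=> rho0; have slE := slack_ydual k m rho0.
have cp := inner_slackF_solF k m rho0.
rewrite (auglag_complementary slE cp) (inner_dual_complementary slE cp).
by rewrite innerC linear0.
Qed.

Lemma spurious_blockF (R : realType) (k m : nat) (rho : R) :
  (0 < k)%N -> 0 < rho ->
  spurious_local_minimizer
    (ALBM_objective 0 (@weighted_op R k m) (weighted_op (gram (solF R k m))) rho
      (@ydual R k m rho) (k := k)) (blockF R k m).
Proof.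
move=> k0 rho0; have rho_ge0 := ltW rho0; split.
  (* This radius gives k e = 1/4 and does not depend on rho. *)
  pose e : R := (4 * k%:R)^-1.
  have k_gt0 : 0 < k%:R :> R by rewrite ltr0n.
  have e0 : 0 < e by rewrite invr_gt0 mulr_gt0.
  apply/nbhs_ballP; exists e => // F [_ Fe].
  rewrite /ALBM_objective auglag_blockF //; apply: auglag_ge => //.
    exact: psd_gram.
  apply: (near_blockF_first_row (e := e)) => [|i j]; last exact: Fe.
  by rewrite /e invfM mulrCA mulfV ?mulr1 // gt_eqF.
(* Padding the rank one factor of X0 with zero columns gives a point of value 0, below rho(2 +
   3k/2). *)
pose F0 : 'M[R]_((k + m).+1, k) :=
  Num.sqrt k.+2%:R *: delta_mx ord0 (Ordinal k0).
have F0E : gram F0 = gram (solF R k m).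
  by apply: val_inj; rewrite [LHS]gram_scale_delta // [RHS]gram_solF.
move=> /(_ F0); rewrite /ALBM_objective auglag_blockF // F0E auglag_solF //.
rewrite pmulr_rle0 // leNgt => /negP; apply.
by rewrite ltr_wpDr // mulr_ge0.
Qed.

Theorem mainTheorem8 (R : realType) (n k : nat)
    (hn : (2 <= n)%N) (hk : (1 <= k <= n - 1)%N) :
  exists (m : nat) (C : symmx R n) (A : {linear symmx R n -> 'cV[R]_m})
         (b : 'cV[R]_m),
    primal_simple C A b /\
    exists Xstar : symmx R n,
      [/\ primal_optimal C A b Xstar, \rank Xstar = 1%N &
        forall rho : R, 0 < rho ->
          exists ystar : 'cV[R]_m,
            [/\ dual_optimal C A b ystar,
                strictly_complementary C A b ystar,
                (exists F : 'M[R]_(n, k),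
                   spurious_local_minimizer
                     (ALBM_objective C A b rho ystar (k := k)) F /\
                   \rank F = k) &
                forall X : symmx R n,
                  ALP_optimal C A b rho ystar X <-> X = Xstar]].
Proof.
have [k0 kn] := andP hk.
have [m nE] : exists m, n = (k + m).+1 by exists (n - 1 - k)%N; lia.
subst n; exists _, 0, (@weighted_op R k m), (weighted_op (gram (solF R k m))).
have inj := @weighted_op_inj R k m.
have rk rho : 0 < rho ->
    (\rank (gram (solF R k m)) + \rank (gram (@slackF R k m rho)))%N
    = (k + m).+1.
  by move=> rho0; rewrite rank_gram_solF rank_gram_slackF.
split.
  (* Primal simplicity does not involve rho, so the dual point for rho = 1 is a sufficient
     witness. *)
  exact: (primal_simple_complementary inj (slack_ydual k m ler01)
    (inner_slackF_solF k m ler01) (rk _ ltr01)).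
exists (gram (solF R k m)); split; [| exact: rank_gram_solF |].
  exact/(primal_optimal_injective 0 (solF R k m) inj).
move=> rho rho0; have rho_ge0 := ltW rho0.
have slE := slack_ydual k m rho_ge0; have cp := inner_slackF_solF k m rho_ge0.
exists (@ydual R k m rho); split.
- exact: (dual_optimal_complementary slE cp).
- exact: (strictly_complementary_rank inj slE (rk _ rho0)).
- exists (blockF R k m); split; last exact: rank_blockF.
  exact: spurious_blockF.
- by move=> X; exact: (ALP_optimal_complementary inj slE cp X rho0).
Qed.
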